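(* Let $(X,\Sigma_x,\mu_x)$ and $(U,\Sigma_u,\mu_u)$ be $\sigma$-finite measure spaces with $X\subseteq\mathbb{R}^n$, $U\subseteq\mathbb{R}^m$, and let $F:X\times U\to X$ be measurable. Let $\nu:=F_*(\mu_x\otimes\mu_u)$ be the pushforward measure on $(X,\Sigma_x)$. Suppose that $\nu$ is absolutely continuous with respect to $\mu_x$ (i.e. $\mu_x(A)=0\Rightarrow\nu(A)=0$ for all $A\in\Sigma_x$) and that $\nu(A)=\int_A w\,d\mu_x$ for all $A\in\Sigma_x$ with a function $w=d\nu/d\mu_x\in L^\infty(X,\mu_x)$, and put $M:=\|w\|_{L^\infty(X,\mu_x)}<\infty$. Then the generalized Koopman composition operator $$C_F:\mathcal{H}_x\to\mathcal{H},\qquad (C_F\varphi)(x,u)=\varphi(F(x,u)),$$ is a well-defined bounded linear operator, with operator norm $$\|C_F\|_{\mathcal{H}_x\to\mathcal{H}}:=\sup_{\varphi\in\mathcal{H}_x,\ \|\varphi\|_{\mathcal{H}_x}=1}\|C_F\varphi\|_{\mathcal{H}}\le M^{1/2}.$$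
   Context: $\mathbb{K}$ denotes $\mathbb{R}$ or $\mathbb{C}$. $\mathcal{H}_x:=L^2(X,\mu_x)$ is the Hilbert space of ($\mu_x$-a.e. equivalence classes of) measurable square-integrable functions $X\to\mathbb{K}$, and $\mathcal{H}:=L^2(X\times U,\mu_x\otimes\mu_u)$, where $\mu_x\otimes\mu_u$ is the product measure on $(X\times U,\Sigma_x\otimes\Sigma_u)$. The pushforward is $[F_*(\mu_x\otimes\mu_u)](A):=(\mu_x\otimes\mu_u)(F^{-1}(A))$, $A\in\Sigma_x$, with $F^{-1}(A)=\{(x,u)\in X\times U: F(x,u)\in A\}$. *)

(* Defs.v *)
From HB Require Import structures.
From mathcomp Require Import all_boot all_order all_algebra.
From mathcomp Require Import complex ring lra.
From mathcomp Require Import all_classical all_reals all_analysis.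
From mathcomp Require Import measurable_realfun.

Set Implicit Arguments.
Unset Strict Implicit.
Unset Printing Implicit Defensive.
Import Order.TTheory GRing.Theory Num.Theory.
Import numFieldNormedType.Exports.

Local Open Scope classical_set_scope.
Local Open Scope ring_scope.
Local Open Scope quotient_scope.

(* The measurable space (T, S).  A [measurableType] is pointed, hence the
   point [x0]; the measurable sets are [<<s S >>], that is, [S] itself as soon
   as [S] is a sigma-algebra (lemma [measurable_mspaceE]). *)
Definition mspace (T : Type) (x0 : T) (S : set (set T)) : Type := T.

Section mspace.
Variables (T : Type) (x0 : T) (S : set (set T)).

HB.instance Definition _ := gen_eqMixin (mspace x0 S).
HB.instance Definition _ := gen_choiceMixin (mspace x0 S).
HB.instance Definition _ := isPointed.Build (mspace x0 S) x0.

Lemma mspace_measurableC (A : set (mspace x0 S)) :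
  <<s S >> A -> <<s S >> (~` A).
Proof. by move=> SA; rewrite -setTD; exact: sigma_algebraCD. Qed.

HB.instance Definition _ := @isMeasurable.Build (sigma_display S)
  (mspace x0 S) <<s S >> (@sigma_algebra0 _ setT S) mspace_measurableC
  (@sigma_algebra_bigcup _ setT S).

Lemma measurable_mspaceE :
  sigma_algebra setT S -> (measurable : set (set (mspace x0 S))) = S.
Proof. exact: sigma_algebra_id. Qed.

End mspace.

Variant scalar_kind := RealScalars | ComplexScalars.

Definition scalar_field (R : realType) (k : scalar_kind) : numFieldType :=
  match k with RealScalars => R | ComplexScalars => R[i] end.

(* The generic norm of R[i] takes its values in R[i]; this one is in R. *)
Definition modulus (R : realType) (k : scalar_kind) : scalar_field R k -> R :=
  match k with
  | RealScalars => fun x : R => `|x|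
  | ComplexScalars => fun z : R[i] => ComplexField.Normc.normc z
  end.

Section modulus.
Variables (R : realType) (k : scalar_kind).
Implicit Types x y : scalar_field R k.

Lemma modulus_ge0 x : 0 <= modulus x.
Proof.
case: k x => [x|[a b]] /=; first exact: (@normr_ge0 _ R).
exact: sqrtr_ge0.
Qed.

Lemma modulus0 : modulus (0 : scalar_field R k) = 0.
Proof. case: k => /=; [exact: (@normr0 _ R)|exact: ComplexField.Normc.normc0]. Qed.

Lemma modulusD x y : modulus (x + y) <= modulus x + modulus y.
Proof.
case: k x y => x y /=; [exact: (@ler_normD _ R)|exact: le_normcD].
Qed.

Lemma modulusM x y : modulus (x * y) = modulus x * modulus y.
Proof.
case: k x y => x y /=; [exact: (@normrM R)|exact: ComplexField.Normc.normcM].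
Qed.

Lemma modulusN x : modulus (- x) = modulus x.
Proof. case: k x => x /=; [exact: (@normrN _ R)|exact: normcN]. Qed.

Lemma modulus_lt x y : (modulus x < modulus y) = (`|x| < `|y|).
Proof.
case: k x y => [x y|x y] /=; first by [].
by rewrite !normc_def ltcR; case: x y => [a b] [c d].
Qed.

Lemma modulus_surj (r : R) : 0 < r ->
  exists2 e : scalar_field R k, 0 < e & modulus e = r.
Proof.
case: k => r0 /=; first by exists r => //; rewrite gtr0_norm.
by exists (r%:C)%C; rewrite ?ltcR //= expr0n/= addr0 sqrtr_sqr gtr0_norm.
Qed.

Lemma modulus_openP (A : set (scalar_field R k)) : open A <->
  forall a, A a -> exists2 e : R, 0 < e & forall y, modulus (a - y) < e -> A y.
Proof.
rewrite openE; split=> [oA a /oA|oA a /oA [e e0 eA]].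
  move=> /nbhs_ballP [e /= e0 eA].
  exists (modulus e) => [|y aye].
    by rewrite -[ltLHS]modulus0 modulus_lt normr0 normr_gt0 gt_eqF.
  by apply: eA; rewrite -ball_normE /= -(gtr0_norm e0) -modulus_lt.
have [f f0 fe] := modulus_surj e0.
apply/nbhs_ballP; exists f => //= y.
rewrite -ball_normE /= -(gtr0_norm f0) -modulus_lt fe; exact: eA.
Qed.

Definition rat_scalar : rat * rat -> scalar_field R k :=
  match k with
  | RealScalars => fun q => ratr q.1 : R
  | ComplexScalars => fun q => (ratr q.1 +i* ratr q.2)%C : R[i]
  end.

Lemma rat_scalar_dense x (e : R) : 0 < e ->
  exists q, modulus (x - rat_scalar q) < e.
Proof.
have H (a r : R) : 0 < r -> exists q : rat, `|a - ratr q| < r.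
  move=> r0; have [|b [/= ab [q _ qb]]] := @dense_rat R (ball a r) _ (ball_open _ _).
    by exists a; exact: ballxx.
  by exists q; rewrite qb; move: ab; rewrite -ball_normE.
rewrite /rat_scalar; case: k x => [x|[a b]] e0 /=.
  by have [q] := H x e e0; exists (q, 0).
have e20 : 0 < e / 2 by rewrite divr_gt0.
have [p pa] := H a _ e20; have [q qb] := H b _ e20.
exists (p, q) => /=.
rewrite [X in Num.sqrt X](_ : _ = `|a - ratr p| ^+ 2 + `|b - ratr q| ^+ 2); last first.
  by rewrite !real_normK ?num_real.
apply: (@le_lt_trans _ _ (`|a - ratr p| + `|b - ratr q|)); last first.
  by rewrite (splitr e) ltrD.
rewrite -[leRHS]ger0_norm ?addr_ge0// -[leRHS]sqrtr_sqr ler_wsqrtr//.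
have : 0 <= `|a - ratr p| * `|b - ratr q| by rewrite mulr_ge0.
by rewrite sqrrD -mulr_natl; lra.
Qed.

End modulus.

Arguments modulus {R k}.
Arguments rat_scalar {R k}.

Definition borel (R : realType) (k : scalar_kind) :=
  g_sigma_algebraType (@open (scalar_field R k)).

Section borel.
Context d (T : measurableType d) (R : realType) (k : scalar_kind).
Implicit Types f g : T -> borel R k.

Lemma borelP f : measurable_fun [set: T] f <->
  forall A : set (scalar_field R k), open A -> measurable (f @^-1` A).
Proof.
split=> [mf A oA|mf].
  by rewrite -[_ @^-1` _]setTI; apply: mf => //; exact: sub_sigma_algebra.
apply: (@measurability _ _ _ _ _ f _ erefl) => _ [A oA <-].
by rewrite setTI; exact: mf.
Qed.

Lemma borelD f g : measurable_fun [set: T] f -> measurable_fun [set: T] g ->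
  measurable_fun [set: T]
    ((fun x => (f x : scalar_field R k) + (g x : scalar_field R k)) : T -> borel R k).
Proof.
move=> /borelP mf /borelP mg; apply/borelP => A oA.
pose B (q : rat * rat) (e : R) := [set y : scalar_field R k | modulus (y - rat_scalar q) < e].
have oB q e : open (B q e).
  apply/modulus_openP => a Ba; exists (e - modulus (a - rat_scalar q)).
    by rewrite subr_gt0.
  move=> y ay; rewrite /B /= -[y](subrK a) -addrA.
  by rewrite (le_lt_trans (modulusD _ _))// -ltrBrDr -modulusN opprB.
pose D (i : rat * rat * (rat * rat) * nat) :=
  `[< forall y z, B i.1.1 (i.2.+1%:R^-1) y -> B i.1.2 (i.2.+1%:R^-1) z -> A (y + z) >].
rewrite [X in measurable X](_ : _ = \bigcup_(i in [set i | D i])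
  (f @^-1` B i.1.1 (i.2.+1%:R^-1) `&` g @^-1` B i.1.2 (i.2.+1%:R^-1))).
  rewrite bigcup_mkcond; apply: countable_bigcupT_measurable => [//|i].
  case: ifP => // _; apply: measurableI; [exact: mf|exact: mg].
apply/seteqP; split=> [x /= Ax|x [[[p q] n]] /asboolP/= + [/= Bx By]]; last exact.
have /modulus_openP /(_ _ Ax) [e e0 eA] := oA.
have [n ne] : exists n : nat, n.+1%:R^-1 < e / 4.
  have e40 : 0 < e / 4 by rewrite divr_gt0.
  exists (Num.truncn (e / 4)^-1).
  by rewrite invf_plt ?posrE// truncnS_gt.
have n0 : (0 : R) < n.+1%:R^-1 by rewrite invr_gt0.
have [p px] := rat_scalar_dense (f x : scalar_field R k) n0.
have [q qx] := rat_scalar_dense (g x : scalar_field R k) n0.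
exists ((p, q), n) => //=; apply/asboolP => /= y z By Bz; apply: eA.
rewrite /B/= in By Bz.
rewrite (_ : _ - _ =
   ((f x : scalar_field R k) - rat_scalar p - (y - rat_scalar p)) +
   ((g x : scalar_field R k) - rat_scalar q - (z - rat_scalar q))); last by ring.
apply: le_lt_trans (modulusD _ _) _.
apply: (@lt_le_trans _ _ (n.+1%:R^-1 *+ 4)); last first.
  by rewrite -[leLHS]mulr_natr -ler_pdivlMr ?ltW.
rewrite -[4%N]/(2 + 2)%N mulrnDr.
by apply: ltrD; apply: le_lt_trans (modulusD _ _) _; rewrite modulusN mulr2n ltrD.
Qed.

Lemma borelZ (c : scalar_field R k) f : measurable_fun [set: T] f ->
  measurable_fun [set: T] ((fun x => c * (f x : scalar_field R k)) : T -> borel R k).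
Proof.
move=> /borelP mf; apply/borelP => A oA.
apply: (mf [set y | A (c * y)]).
apply/modulus_openP => a /=.
have /modulus_openP oA' := oA; move=> /oA' [e e0 eA].
have c1 : 0 < modulus c + 1 by rewrite ltr_wpDl ?modulus_ge0.
exists (e / (modulus c + 1)); first by rewrite divr_gt0.
move=> y; rewrite ltr_pdivlMr// => ay; apply: eA.
rewrite -mulrBr modulusM (le_lt_trans _ ay)// mulrC ler_wpM2l ?modulus_ge0//.
by rewrite lerDl.
Qed.

Lemma measurable_modulus f : measurable_fun [set: T] f ->
  measurable_fun [set: T] (fun x => modulus (f x : scalar_field R k)).
Proof.
move=> /borelP mf.
apply: (measurability _ (RGenOInfty.measurableE R)).
move=> _ [_ [r ->] <-]; rewrite setTI.
rewrite (_ : _ @^-1` _ = f @^-1` [set y : scalar_field R k | r < modulus y]); last first.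
  by apply/seteqP; split => x /=; rewrite in_itv/= andbT.
apply: mf; apply/modulus_openP => a ra.
exists (modulus a - r); first by rewrite subr_gt0.
move=> y ay; rewrite /=.
have := modulusD (a - y) y; rewrite subrK; lra.
Qed.

End borel.

Section L2.
Context d (T : measurableType d) (R : realType) (k : scalar_kind).
Variable mu : {measure set T -> \bar R}.
Local Notation K := (scalar_field R k).

(* [K^o] is K as a vector space over itself: it makes [T -> K^o] a vector
   space over K. *)
Definition L2pred : {pred T -> K^o} :=
  mem [set f : T -> K^o | measurable_fun [set: T] (f : T -> borel R k) /\
                          finite_norm mu 2%:E (fun x => modulus (f x : K))].

Lemma L2predP (f : T -> K^o) : reflect
  (measurable_fun [set: T] (f : T -> borel R k) /\
   finite_norm mu 2%:E (fun x => modulus (f x : K))) (f \in L2pred).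
Proof. by apply: (iffP idP) => [/set_mem|/mem_set]. Qed.

Lemma L2_submod_closed : submod_closed L2pred.
Proof.
have le12 : (1 <= 2%:E :> \bar R)%E by rewrite lee_fin ler1n.
have LP (f : T -> K^o) : f \in L2pred ->
    (fun x => modulus (f x : K)) \in Lfun mu 2%:E.
  move=> /L2predP [mf ff]; apply/andP; split; apply: mem_set => //.
  exact: measurable_modulus.
split.
  apply/L2predP; split; first exact: measurable_cst.
  rewrite /finite_norm (_ : _ \o _ = cst 0%E) ?Lnorm0 ?eqe//.
  by apply/funext => x /=; rewrite modulus0.
move=> c f g Lf Lg; have [[mf _] [mg _]] := (L2predP _ Lf, L2predP _ Lg).
apply/L2predP; split; first exact: borelD (borelZ c mf) mg.
pose h : T -> R := modulus c \*: (fun x => modulus (f x : K)) +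
                   (fun x => modulus (g x : K)).
have : h \in Lfun mu 2%:E.
  have [_ Hc] := Lfun_submod_closed mu le12.
  by apply: Hc; exact: LP.
move=> /andP[/set_mem mh /set_mem]; apply: le_lt_trans.
rewrite /finite_norm unlock/=.
apply: gt0_ler_poweR; rewrite ?invr_ge0// ?in_itv/= ?leey ?andbT;
  do ?exact: integral_ge0.
apply: ge0_le_integral => //=.
- apply/measurable_EFinP/(@measurableT_comp _ _ _ _ _ _ (@powR R ^~ 2)) => //.
  apply: measurableT_comp => //.
  exact: (measurable_modulus (borelD (borelZ c mf) mg)).
- apply/measurable_EFinP/(@measurableT_comp _ _ _ _ _ _ (@powR R ^~ 2)) => //.
  exact: measurableT_comp.
move=> x _; rewrite lee_fin ge0_ler_powR ?nnegrE//.
rewrite !ger0_norm; last 2 first.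
  by apply: addr_ge0; [apply: mulr_ge0|]; exact: modulus_ge0.
  exact: modulus_ge0.
by apply: le_trans (modulusD _ _) _; rewrite modulusM.
Qed.

HB.instance Definition _ := GRing.isSubmodClosed.Build _ _ L2pred
  L2_submod_closed.

(* Square-integrable functions; [L2] below is the quotient by a.e. equality. *)
Record L2fun := MkL2fun {
  L2fun_val :> T -> K^o;
  _ : L2fun_val \in L2pred }.

HB.instance Definition _ := [isSub for L2fun_val].
HB.instance Definition _ := [Choice of L2fun by <:].
HB.instance Definition _ := [SubChoice_isSubLmodule of L2fun by <:].

Definition L2null : {pred L2fun} := mem [set f : L2fun | f = 0 %[ae mu]].

Lemma L2nullP (f : L2fun) : reflect (f = 0 %[ae mu]) (f \in L2null).
Proof. by apply: (iffP idP) => [/set_mem|/mem_set]. Qed.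

Lemma L2null_submod_closed : submod_closed L2null.
Proof.
split; first exact/L2nullP/ae_eq_refl.
move=> c f g /L2nullP f0 /L2nullP g0; apply/L2nullP.
move: f0 g0; apply: filterS2 => x /(_ I) f0 /(_ I) g0 _.
rewrite -[LHS]/(c *: f x + g x) f0 g0 /=.
by rewrite [_ *: _]mulr0 addr0.
Qed.

HB.instance Definition _ := GRing.isSubmodClosed.Build _ _ L2null
  L2null_submod_closed.

Definition L2 : Type := Quotient.quot (L2null : zmodClosed _).
HB.instance Definition _ := GRing.Zmodule.on L2.
HB.instance Definition _ := EqQuotient.on L2.

Definition L2class (f : L2fun) : L2 := \pi_L2 f.

Lemma L2classP (f g : L2fun) : L2class f = L2class g <-> f = g %[ae mu].
Proof.
rewrite /L2class; split.
  move/eqP; rewrite -Quotient.idealrBE => /L2nullP.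
  apply: filterS => x /(_ I) + _ => /eqP.
  by rewrite -[X in X == _]/(f x - g x) subr_eq0 => /eqP.
move=> fg; apply/eqP; rewrite -Quotient.idealrBE; apply/L2nullP.
move: fg; apply: filterS => x /(_ I) fg _.
by rewrite -[LHS]/(f x - g x) fg subrr.
Qed.

Lemma L2classD f g : L2class (f + g) = L2class f + L2class g.
Proof. exact: (@pi_addr _ _ _ _ _ L2). Qed.

Definition L2scale (c : K) (f : L2) : L2 := L2class (c *: repr f).

Lemma L2classZ c f : L2class (c *: f) = L2scale c (L2class f).
Proof.
apply/L2classP; have /L2classP : L2class (repr (L2class f)) = L2class f.
  exact: reprK.
apply: filterS => x /(_ I) fg _.
by rewrite -[LHS]/(c *: f x) -[RHS]/(c *: repr (L2class f) x) fg.
Qed.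

Lemma L2classK (f : L2) : L2class (repr f) = f. Proof. exact: reprK. Qed.

Lemma L2scalerA a b f : L2scale a (L2scale b f) = L2scale (a * b) f.
Proof. by rewrite -[f]L2classK -!L2classZ scalerA. Qed.

Lemma L2scale1r : left_id 1 L2scale.
Proof. by move=> f; rewrite -[f in LHS]L2classK -L2classZ scale1r L2classK. Qed.

Lemma L2scalerDr : right_distributive L2scale +%R.
Proof.
move=> a f g; rewrite -[f]L2classK -[g]L2classK.
by rewrite -L2classD -!L2classZ scalerDr L2classD.
Qed.

Lemma L2scalerDl f : {morph L2scale^~ f : a b / a + b}.
Proof.
move=> a b; rewrite -[f]L2classK -!L2classZ.
by rewrite scalerDl L2classD.
Qed.

HB.instance Definition _ := GRing.Zmodule_isLmodule.Build K L2
  L2scalerA L2scale1r L2scalerDr L2scalerDl.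

Lemma L2class_linear : linear L2class.
Proof. by move=> c f g; rewrite L2classD L2classZ. Qed.

(* The norm of L2 is computed on an arbitrary representative ([L2normE]). *)
Definition L2norm (f : L2) : R :=
  fine ('N[mu]_2%:E[EFin \o (fun x => modulus (repr f x : K))])%E.

Lemma L2normE (f : L2fun) :
  (L2norm (L2class f))%:E = ('N[mu]_2%:E[EFin \o (fun x => modulus (f x : K))])%E.
Proof.
have mN (g : L2fun) : measurable_fun [set: T] (fun x => modulus (g x : K)).
  by apply: measurable_modulus; case: g => g /= /L2predP[].
rewrite /L2norm.
set g := repr _.
have gf : g = f %[ae mu] by apply/L2classP; exact: reprK.
have -> : ('N[mu]_2%:E[EFin \o (fun x => modulus (g x : K))] =
           'N[mu]_2%:E[EFin \o (fun x => modulus (f x : K))])%E.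
  rewrite unlock; congr (_ `^ _)%E; apply: ae_eq_integral => //=.
  - apply/measurable_EFinP/(@measurableT_comp _ _ _ _ _ _ (@powR R ^~ 2)) => //.
    exact: measurableT_comp (mN g).
  - apply/measurable_EFinP/(@measurableT_comp _ _ _ _ _ _ (@powR R ^~ 2)) => //.
    exact: measurableT_comp (mN f).
  by move: gf; apply: filterS => x /(_ I) gf _; rewrite gf.
rewrite fineK// ge0_fin_numE ?Lnorm_ge0//.
by case: (f) => h /= /L2predP[].
Qed.

End L2.

Arguments L2pred {d T R} k mu.
Arguments L2fun {d T R} k mu.
Arguments L2 {d T R} k mu.

Section operators.
Context d (T : measurableType d) d' (T' : measurableType d').
Context (R : realType) (k : scalar_kind).
Variables (mu : {measure set T -> \bar R}) (mu' : {measure set T' -> \bar R}).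

Definition bounded_operator (C : L2 k mu -> L2 k mu') : Prop :=
  exists c : R, forall f, L2norm (C f) <= c * L2norm f.

(* The supremum is taken in the extended reals, so it is +oo for an unbounded
   operator (and -oo if [L2 k mu] is the zero space). *)
Definition opnorm (C : L2 k mu -> L2 k mu') : \bar R :=
  ereal_sup [set (L2norm (C f))%:E | f in [set f | L2norm f = 1]].

(* [C] acts on classes by sending the class of phi to that of phi \o F, for
   every representative phi. *)
Definition is_composition_operator (F : T' -> T) (C : L2 k mu -> L2 k mu') :=
  forall phi : L2fun k mu, exists2 psi : L2fun k mu',
    (psi : T' -> scalar_field R k) = phi \o F & C (L2class phi) = L2class psi.

End operators.

(* Main.v *)
Require Import Defs.
From HB Require Import structures.
From mathcomp Require Import all_boot all_order all_algebra.
From mathcomp Require Import all_classical all_reals all_analysis.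
From mathcomp Require Import measurable_realfun ess_sup_inf.

(** The density [w] is bounded by [M = 'N[mux]_+oo[w]] almost everywhere, so
    [nu A = \int_A w <= M * mux A] for every measurable [A]
    ([integral_le_Lnormy]): the pushforward measure is dominated by [M] times
    [mux].  An inequality between measures is inherited by the integrals of
    nonnegative functions, so by change of variables
      [\int |phi (F z)|^2 dmu = \int |phi|^2 dnu <= M * \int |phi|^2 dmux]
    ([ge0_le_integral_comp]).  Taking square roots shows both that [phi \o F]
    is square-integrable ([comp_L2pred]) and that composition with [F] has norm
    at most [M `^ 2^-1] ([koopman_norm_le]).  The same domination makes the
    preimage by [F] of a null set a null set ([ae_eq_comp]), so composition
    descends to almost everywhere classes ([koopman]), where it is linear
    because it is linear on functions.

    The argument is carried out for a measurable map [F] between arbitrary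
    measure spaces such that [mu' (F @^-1` A) <= c * mu A]. *)

Set Implicit Arguments.
Unset Strict Implicit.
Import Order.TTheory GRing.Theory Num.Theory.
Import numFieldNormedType.Exports.
Local Open Scope classical_set_scope.
Local Open Scope ring_scope.

Lemma ae_le_Lnormy d (T : measurableType d) (R : realType)
    (mu : {measure set T -> \bar R}) (f : T -> \bar R) :
  {ae mu, forall x, `|f x| <= 'N[mu]_+oo[f]}%E.
Proof.
(* For the zero measure the norm is 0 by convention, and every property holds
   almost everywhere. *)
rewrite unlock; case: ifPn => [_|]; first exact: (ess_sup_ge mu (abse \o f)).
rewrite -leNgt measure_le0 => /eqP T0.
by exists [set: T]; split.
Qed.

(** Passing to [`|f|] first makes the comparison with the constant one between
    nonnegative functions. *)
Lemma integral_le_Lnormy d (T : measurableType d) (R : realType)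
    (mu : {measure set T -> \bar R}) (f : T -> \bar R) (A : set T) :
  measurable A -> measurable_fun [set: T] f ->
  (\int[mu]_(x in A) f x <= 'N[mu]_+oo[f] * mu A)%E.
Proof.
move=> mA mf; have mfA := measurable_funTS mf : measurable_fun A f.
apply: (le_trans (lee_abs _)); apply: (le_trans (le_abse_integral mu mA mfA)).
rewrite -integral_cst//; apply: ae_ge0_le_integral => //.
- exact: measurableT_comp.
- by move=> x _; exact: Lnorm_ge0.
- by have := ae_le_Lnormy mu f; apply: filterS => x fx _.
Qed.

Section dominated_pushforward.
Context d (T : measurableType d) d' (T' : measurableType d') (R : realType).
Variables (mu : {measure set T -> \bar R}) (mu' : {measure set T' -> \bar R}).
Variables (F : T' -> T) (c : {nonneg R}).
Hypothesis mF : measurable_fun [set: T'] F.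
Hypothesis muF : forall A, measurable A ->
  (pushforward mu' F A <= c%:num%:E * mu A)%E.

(** The left-hand side is the integral of [g] for the pushforward of [mu'], and
    the right-hand side its integral for the measure [c * mu], which dominates
    that pushforward. *)
Lemma ge0_le_integral_comp (g : T -> \bar R) :
  (forall x, 0 <= g x)%E -> measurable_fun [set: T] g ->
  (\int[mu']_x g (F x) <= c%:num%:E * \int[mu]_x g x)%E.
Proof.
move=> g0 mg.
rewrite -(@ge0_integral_mscale _ _ _ mu _ measurableT c)//.
have := @ge0_integral_pushforward _ _ _ _ R F mF mu' [set: T] g measurableT mg.
rewrite preimage_setT => <-//.
(* [pushforward mu' F] is a measure only for a bundled measurable function. *)
pose F' : {mfun T' >-> T} := HB.pack F (isMeasurableFun.Build _ _ _ _ _ mF).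
exact: (@ge0_le_measure_integral _ _ _ (pushforward mu' F') (mscale c mu)).
Qed.

Lemma Lnorm2_comp_le (h : T -> R) :
  measurable_fun [set: T] h ->
  ('N[mu']_2%:E[EFin \o (h \o F)] <=
   c%:num%:E `^ 2^-1 * 'N[mu]_2%:E[EFin \o h])%E.
Proof.
move=> mh; rewrite unlock -poweRM ?lee_fin//; last first.
  by apply: integral_ge0 => x _; exact: poweR_ge0.
apply: gt0_ler_poweR; rewrite ?invr_ge0//.
- by rewrite in_itv/= leey andbT; exact: integral_ge0.
- rewrite in_itv/= leey andbT; apply: mule_ge0; first by rewrite lee_fin.
  exact: integral_ge0.
apply: (ge0_le_integral_comp (g := fun x => `|(h x)%:E| `^ 2)%E) => [x|].
  exact: poweR_ge0.
apply/measurable_EFinP/(@measurableT_comp _ _ _ _ _ _ (@powR R ^~ 2)) => //.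
exact: measurableT_comp.
Qed.

Variable k : scalar_kind.

Lemma comp_L2pred (phi : L2fun k mu) :
  (phi : T -> (scalar_field R k)^o) \o F \in L2pred k mu'.
Proof.
have /L2predP[mphi phi2] := valP phi.
apply/L2predP; split; first exact: (measurableT_comp mphi mF).
apply: le_lt_trans (Lnorm2_comp_le (measurable_modulus mphi)) _.
by rewrite lte_mul_pinfty// ?poweR_ge0// poweR_EFin.
Qed.

Definition L2fun_comp (phi : L2fun k mu) : L2fun k mu' :=
  MkL2fun (comp_L2pred phi).

(** If [f] and [g] agree outside a null set [N], the compositions agree outside
    [F @^-1` N], whose measure is at most [c * 0]. *)
Lemma ae_eq_comp (V : Type) (f g : T -> V) :
  f = g %[ae mu] -> f \o F = g \o F %[ae mu'].
Proof.
move=> [N [mN N0 fgN]]; exists (F @^-1` N); split=> [||x /= fgx].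
- by rewrite -[_ @^-1` _]setTI; exact: mF.
- by apply/eqP; rewrite -measure_le0 (le_trans (muF mN))// N0 mule0.
- exact: fgN.
Qed.

(** Any representative gives the same class, by [koopmanE]. *)
Definition koopman (f : L2 k mu) : L2 k mu' :=
  L2class (L2fun_comp (repr f)).

Lemma koopmanE (phi : L2fun k mu) :
  koopman (L2class phi) = L2class (L2fun_comp phi).
Proof. by apply/L2classP/ae_eq_comp/L2classP; exact: L2classK. Qed.

Lemma koopman_linear : linear koopman.
Proof.
move=> a f g; rewrite -[f]L2classK -[g]L2classK -L2class_linear !koopmanE.
by rewrite -L2class_linear; congr L2class; exact: val_inj.
Qed.

HB.instance Definition _ :=
  GRing.isLinear.Build _ _ _ _ koopman koopman_linear.

Lemma koopman_is_composition_operator : is_composition_operator F koopman.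
Proof. by move=> phi; exists (L2fun_comp phi) => //; exact: koopmanE. Qed.

Lemma koopman_norm_le (f : L2 k mu) :
  L2norm (koopman f) <= c%:num `^ 2^-1 * L2norm f.
Proof.
have /L2predP[mf _] := valP (repr f).
rewrite -[f]L2classK koopmanE -lee_fin EFinM !L2normE.
exact: (Lnorm2_comp_le (measurable_modulus mf)).
Qed.

End dominated_pushforward.

Unset Implicit Arguments.
Set Strict Implicit.

Theorem mainTheorem1 (R : realType) (k : scalar_kind) (n m : nat)
    (X : set 'rV[R]_n) (x0 : X) (Sx : set (set X))
    (U : set 'rV[R]_m) (u0 : U) (Su : set (set U))
    (Sx_sigma : sigma_algebra [set: X] Sx)
    (Su_sigma : sigma_algebra [set: U] Su)
    (mux : {sigma_finite_measure set (mspace x0 Sx) -> \bar R})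
    (muu : {sigma_finite_measure set (mspace u0 Su) -> \bar R})
    (F : mspace x0 Sx * mspace u0 Su -> mspace x0 Sx)
    (F_measurable : measurable_fun [set: mspace x0 Sx * mspace u0 Su] F)
    (w : mspace x0 Sx -> R) :
  let mu : {measure set (mspace x0 Sx * mspace u0 Su) -> \bar R} :=
    (mux \x muu)%E in
  let nu := pushforward mu F in
  nu `<< mux ->
  w \in Lfun mux +oo%E ->
  (forall A : set X, Sx A -> nu A = \int[mux]_(x in A) (w x)%:E)%E ->
  let M := ('N[mux]_+oo[EFin \o w])%E in
  [/\ forall phi : L2fun k mux, phi \o F \in L2pred k mu,
      forall phi psi : L2fun k mux,
        phi = psi %[ae mux] -> phi \o F = psi \o F %[ae mu] &
      exists C : {linear L2 k mux -> L2 k mu},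
        [/\ is_composition_operator F C,
            bounded_operator C &
            (opnorm C <= M `^ 2^-1)%E]].
Proof.
move=> mu nu nu_mux /andP[/set_mem mw /set_mem w_fin] nuE M.
have M_fin : M \is a fin_num by rewrite ge0_fin_numE ?Lnorm_ge0.
have M_ge0 : 0 <= fine M by rewrite fine_ge0 ?Lnorm_ge0.
pose c : {nonneg R} := NngNum M_ge0.
have cE : c%:num%:E = M by rewrite /= fineK.
have nu_le (A : set (mspace x0 Sx)) : measurable A ->
    (nu A <= c%:num%:E * mux A)%E.
  move=> mA; rewrite cE nuE; last by rewrite -(measurable_mspaceE x0 Sx_sigma).
  exact/integral_le_Lnormy/measurable_EFinP.
split=> [phi|phi psi|]; first exact: (comp_L2pred F_measurable nu_le).
  exact: (ae_eq_comp F_measurable nu_le).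
exists (koopman F_measurable nu_le (k := k)); split.
- exact: koopman_is_composition_operator.
- by exists (c%:num `^ 2^-1) => f; exact: koopman_norm_le.
- apply: ge_ereal_sup => _ /= [f f1 <-].
  have := koopman_norm_le F_measurable nu_le f.
  by rewrite f1 mulr1 -cE.
Qed.
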